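(* Let $n\ge2$. The $h$-polynomial of the bipermutahedral fan $\Sigma_{n,n}$ equals the $n$th biEulerian polynomial $B_n(x)=\sum_{i=0}^{2n-2}b(n,i)x^i$; that is, $h_i(\Sigma_{n,n})=b(n,i)$ for $0\le i\le 2n-2$, where $b(n,i)$ is the number of bipermutations of $[n]$ with exactly $i$ descents.
   Context: Let $N_n=\mathbb{R}^n/\mathbb{R}(1,\dots,1)$; for $S\subseteq[n]$ let $\mathsf{e}_S$, $\mathsf{f}_S$ be the images in the first, second factor of $N_n\times N_n$ of the indicator vector of $S$. A bipermutation of $[n]$ is a sequence $\mathsf{B}=b_1|\cdots|b_{2n-1}$ of elements of $[n]$ in which one element $k=k(\mathsf{B})$ appears exactly once and every other element exactly twice. The bipermutahedral fan $\Sigma_{n,n}$ is the complete simplicial fan in $N_n\times N_n$ (dimension $2n-2$) whose maximal cones are $\mathrm{cone}\{\mathsf{e}_{\{b_1,\dots,b_m\}}+\mathsf{f}_{\{b_{m+1},\dots,b_{2n-1}\}}:1\le m\le 2n-2\}$ for the bipermutations $\mathsf{B}$, together with all their faces. For a $D$-dimensional simplicial fan with $f_i$ cones of dimension $i$, its $h$-vector $(h_0,\dots,h_D)$ is defined by $\sum_{i=0}^D h_i(x+1)^{D-i}=\sum_{i=0}^D f_ix^{D-i}$, and its $h$-polynomial is $\sum_i h_ix^i$. Descents: write $\mathsf{B}$ with first occurrences of each $i\ne k$ as $i$ and second occurrences as $\overline i$; the single occurrence of $k$ is regarded as $k$ when compared with an unbarred letter and as $\overline k$ when compared with a barred letter.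 Two consecutive letters $i|j$ form a descent if (a) both are unbarred and $i>j$; or (b) both are barred and $i<j$; or (c) $i$ is an unbarred element of $[n]\setminus\{k\}$, $j$ is a barred element $\overline{j'}$ with $j'\ne k$, and $i>k$; or (d) $i$ is barred with $i\ne\overline k$, $j$ is an unbarred element of $[n]\setminus\{k\}$, and $j<k$. (Here comparisons of barred letters $\overline a,\overline b$ compare $a,b$.) *)

(* Defs.v *)
From HB Require Import structures.
From mathcomp Require Import all_boot all_order all_algebra finmap.
From mathcomp Require Import boolp classical_sets functions cardinality reals.

Set Implicit Arguments.
Unset Strict Implicit.
Unset Printing Implicit Defensive.

Import Order.TTheory GRing.Theory Num.Theory.
Local Open Scope ring_scope.
Local Open Scope quotient_scope.
Local Open Scope classical_set_scope.

Section QuotientSpace.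
Variables (K : fieldType) (V : vectType K) (U : {vspace V}).

Definition quotv : Type :=
  Quotient.quot (GRing.ZmodClosed.clone V (pred_of_vspace U) _).
HB.instance Definition _ := GRing.Zmodule.on quotv.

Definition quotv_pi (v : V) : quotv := \pi_(Quotient.quot _) v.

Lemma quotv_eq u v : (quotv_pi u = quotv_pi v) <-> (u - v \in U).
Proof.
rewrite -[u - v \in U]/(u - v \in GRing.ZmodClosed.clone V (pred_of_vspace U) _).
by rewrite Quotient.idealrBE; split=> /eqP.
Qed.

Lemma quotv_reprK (x : quotv) : quotv_pi (repr x) = x.
Proof. exact: reprK. Qed.

Lemma quotv_piD : {morph quotv_pi : u v / u + v}.
Proof. by move=> u v; rewrite /quotv_pi raddfD. Qed.

Definition quotv_scale (a : K) (x : quotv) : quotv := quotv_pi (a *: repr x).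

Lemma quotv_scale_pi a v : quotv_scale a (quotv_pi v) = quotv_pi (a *: v).
Proof.
by apply/quotv_eq; rewrite -scalerBr memvZ //; apply/quotv_eq/quotv_reprK.
Qed.

Fact quotv_scalerA a b x :
  quotv_scale a (quotv_scale b x) = quotv_scale (a * b) x.
Proof. by rewrite -[x]quotv_reprK !quotv_scale_pi scalerA. Qed.
Fact quotv_scale1r : left_id 1 quotv_scale.
Proof. by move=> x; rewrite -[x]quotv_reprK quotv_scale_pi scale1r. Qed.
Fact quotv_scalerDr : right_distributive quotv_scale +%R.
Proof.
move=> a x y; rewrite -[x]quotv_reprK -[y]quotv_reprK.
by rewrite !quotv_scale_pi -!quotv_piD quotv_scale_pi scalerDr.
Qed.
Fact quotv_scalerDl x : {morph quotv_scale^~ x : a b / a + b}.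
Proof.
by move=> a b; rewrite -[x]quotv_reprK !quotv_scale_pi -quotv_piD scalerDl.
Qed.

HB.instance Definition _ := GRing.Zmodule_isLmodule.Build K quotv
  quotv_scalerA quotv_scale1r quotv_scalerDr quotv_scalerDl.

Fact quotv_pi_linear : linear quotv_pi.
Proof.
by move=> a u v; rewrite quotv_piD -quotv_scale_pi.
Qed.
HB.instance Definition _ :=
  GRing.isLinear.Build K V quotv _ quotv_pi quotv_pi_linear.

Let projC := daddv_pi U^C%VS U.

Let projC_eq0 u : u \in U -> projC u = 0.
Proof.
have CU0 : (U^C :&: U = 0)%VS by rewrite capvC capv_compl.
move=> Uu; have := @daddv_pi_add _ _ U^C%VS U u CU0.
rewrite addvC addv_complf memvf => /(_ isT).
rewrite (daddv_pi_id _ Uu) ?capv_compl // => /(canRL (addrK u)) ->.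
by rewrite subrr.
Qed.

Let projC_sub u : u - projC u \in U.
Proof.
have CU0 : (U^C :&: U = 0)%VS by rewrite capvC capv_compl.
have := @daddv_pi_add _ _ U^C%VS U u CU0.
rewrite addvC addv_complf memvf => /(_ isT) {1}<-.
by rewrite addrC addKr memv_pi.
Qed.

Let projC_repr v : projC (repr (quotv_pi v)) = projC v.
Proof.
apply/eqP; rewrite -subr_eq0 -linearB; apply/eqP/projC_eq0.
by apply/quotv_eq/quotv_reprK.
Qed.

Let to_rV (x : quotv) : 'rV[K]_(\dim U^C) :=
  \row_i coord (vbasis U^C) i (projC (repr x)).

Fact quotv_vector_axiom : Vector.axiom (\dim U^C) quotv.
Proof.
exists to_rV.
  move=> a x y; rewrite -[x]quotv_reprK -[y]quotv_reprK -linearP.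
  by apply/rowP => i; rewrite !mxE !projC_repr !linearP.
exists (fun r : 'rV_(\dim U^C) => quotv_pi (\sum_i r 0 i *: (vbasis U^C)`_i)).
  move=> x; rewrite -[RHS]quotv_reprK.
  under eq_bigr do rewrite mxE.
  rewrite -(coord_vbasis (memv_pi _ _ _)); apply/quotv_eq.
  by rewrite -opprB memvN projC_sub.
move=> r; apply/rowP => i; rewrite mxE projC_repr /projC daddv_pi_id.
- by rewrite coord_sum_free // (basis_free (vbasisP _)).
- by rewrite capvC capv_compl.
- by apply: memv_suml => j _; rewrite memvZ // vbasis_mem // mem_nth // size_tuple.
Qed.

HB.instance Definition _ :=
  Lmodule_hasFinDim.Build K quotv quotv_vector_axiom.

End QuotientSpace.

Section Cones.
Variables (R : realType) (V : vectType R).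
Implicit Types (C F : set V) (s : seq V).

Definition cone s : set V :=
  [set x | exists2 c : 'I_(size s) -> R,
             forall i, 0 <= c i & x = \sum_i c i *: s`_i].

(* The faces of a polyhedral cone are its intersections with supporting
   hyperplanes [u = 0]; the choice [u = 0] makes the cone a face of itself. *)
Definition face_of F C : Prop :=
  exists2 u : 'Hom(V, R^o),
    forall x, C x -> 0 <= u x & F = C `&` [set x | u x = 0].

(* The dimension of a cone is that of its linear span, i.e. of the least
   subspace that contains it. *)
Definition cone_dim C (d : nat) : Prop :=
  exists U : {vspace V},
    [/\ forall x, C x -> x \in U,
        forall W : {vspace V}, (forall x, C x -> x \in W) -> (U <= W)%VS
      & \dim U = d].

(* [fset_set] sends infinite sets to the empty one; the fans considered here
   are finite (see [finite_bipermutahedral_fan]). *)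
Definition f_vector (Sigma : set (set V)) (d : nat) : nat :=
  #|` fset_set [set C | Sigma C /\ cone_dim C d]|.

Lemma face_of_cone s F : face_of F (cone s) ->
  exists A : {set 'I_(size s)}, F =
    [set x | exists2 c : 'I_(size s) -> R,
       forall i, 0 <= c i /\ (i \notin A -> c i = 0) & x = \sum_i c i *: s`_i].
Proof.
case=> u u_ge0 ->; exists [set i : 'I_(size s) | u s`_i == 0]%SET.
have us_ge0 (i : 'I_(size s)) : 0 <= u s`_i.
  apply: u_ge0; exists (fun j => (j == i)%:R) => [j|]; first by rewrite ler0n.
  rewrite (bigD1 i) //= eqxx scale1r big1 ?addr0 // => j /negPf ->.
  by rewrite scale0r.
apply/seteqP; split=> x /=; last first.
  case=> c cP ->; split; first by exists c => // i; have [] := cP i.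
  rewrite linear_sum big1 // => i _; rewrite linearZ /=.
  have [_] := cP i; rewrite inE; case: (eqVneq (u s`_i) 0) => [->|_ ->] //.
    by rewrite scaler0.
  by rewrite scale0r.
case=> [[c c_ge0 ->]] ux0; exists c => // i; split=> //; rewrite inE => usi.
move: ux0; rewrite linear_sum /= => /eqP; rewrite psumr_eq0; last first.
  by move=> j _; rewrite linearZ /=; exact: (mulr_ge0 (c_ge0 j) (us_ge0 j)).
move=> /allP/(_ i (mem_index_enum i)) /=.
by rewrite linearZ /= mulf_eq0 (negPf usi) orbF => /eqP.
Qed.

Lemma finite_faces_cone s : finite_set [set F | face_of F (cone s)].
Proof.
pose g (A : {set 'I_(size s)}) : set V :=
  [set x | exists2 c : 'I_(size s) -> R,
     forall i, 0 <= c i /\ (i \notin A -> c i = 0) & x = \sum_i c i *: s`_i].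
apply: (@sub_finite_set _ _ (g @` setT)).
  by move=> F /face_of_cone[A ->]; exists A.
exact/finite_image/finite_finset.
Qed.

End Cones.

Definition is_h_vector (D : nat) (f : nat -> nat) (h : {ffun 'I_D.+1 -> int}) :
    Prop :=
  \sum_(i < D.+1) h i *: ('X + 1) ^+ (D - i)
    = \sum_(i < D.+1) (f i)%:Z *: 'X^(D - i) :> {poly int}.

Definition h_vector (D : nat) (f : nat -> nat) : {ffun 'I_D.+1 -> int} :=
  xget [ffun=> 0] [set h | is_h_vector f h].

Definition h_polynomial (D : nat) (f : nat -> nat) : {poly int} :=
  \sum_(i < D.+1) h_vector D f i *: 'X^i.

Lemma poly_sub_revE D (c : 'I_D.+1 -> int) :
  \sum_(i < D.+1) c i *: 'X^(D - i) = \poly_(j < D.+1) c (inord (D - j)).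
Proof.
rewrite poly_def (reindex_inj rev_ord_inj) /=; apply: eq_bigr => i _.
have leiD : (i <= D)%N by rewrite -ltnS.
rewrite subSS subKn //; congr (c _ *: _); apply/val_inj => /=.
by rewrite inordK ?subSS // ltnS leq_subr.
Qed.

Lemma is_h_vectorE D f (h : {ffun 'I_D.+1 -> int}) :
  is_h_vector f h <->
  \sum_(i < D.+1) h i *: 'X^(D - i)
    = (\sum_(i < D.+1) (f i)%:Z *: 'X^(D - i)) \Po ('X - 1) :> {poly int}.
Proof.
have E (g : 'I_D.+1 -> int) (q : {poly int}) :
    (\sum_(i < D.+1) g i *: 'X^(D - i)) \Po q
    = \sum_(i < D.+1) g i *: q ^+ (D - i).
  rewrite raddf_sum /=; apply: eq_bigr => i _.
  by rewrite comp_polyZ comp_Xn_poly.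
rewrite /is_h_vector -(E h ('X + 1)); split=> [<-|->].
  by rewrite -comp_polyA comp_polyD comp_polyX comp_polyC subrK comp_polyXr.
rewrite -comp_polyA comp_polyB comp_polyX comp_polyC.
by rewrite addrK comp_polyXr.
Qed.

Lemma is_h_vector_inj D f (h h' : {ffun 'I_D.+1 -> int}) :
  is_h_vector f h -> is_h_vector f h' -> h = h'.
Proof.
move=> /is_h_vectorE Eh /is_h_vectorE; rewrite -Eh !poly_sub_revE => E.
apply/ffunP => i; have leiD : (i <= D)%N by rewrite -ltnS.
have := congr1 (fun p : {poly int} => p`_(D - i)) E.
by rewrite !coef_poly ltnS leq_subr subKn // inord_val.
Qed.

Lemma h_vectorP D f : is_h_vector f (h_vector D f).
Proof.
apply: (@xgetPex _ _ [set h | is_h_vector f h]).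
set p := \sum_(i < D.+1) (f i)%:Z *: 'X^(D - i) : {poly int}.
exists [ffun i : 'I_D.+1 => (p \Po ('X - 1))`_(D - i)].
apply/is_h_vectorE; rewrite -/p.
under eq_bigr do rewrite ffunE.
rewrite poly_sub_revE; apply/polyP => j; rewrite coef_poly.
case: ltnP => [ltjD|leDj].
  by rewrite inordK ?ltnS ?leq_subr // subKn.
rewrite nth_default //; apply: leq_trans leDj.
have: (size p <= D.+1)%N by rewrite /p poly_sub_revE size_poly.
rewrite -(size_comp_poly2 p (size_XsubC (1 : int))).
by rewrite polyC1.
Qed.

(* The ground set of size n is ['I_n], i.e. letters are shifted by one. *)

Section Bipermutations.
Variable n : nat.
Notation word := ((2 * n - 1).-tuple 'I_n).
Implicit Types (B : word) (k : 'I_n).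

Definition bipermutation B : bool :=
  [exists k, (count_mem k B == 1%N)
     && [forall i, (i != k) ==> (count_mem i B == 2%N)]].

(* The letter at position [p] (counted from 0) is barred when it is a second
   occurrence.  By this definition the letter [k] itself is never barred. *)
Definition barred k B (p : nat) : bool := nth k B p \in take p B.

(* [k] stands for the letter that occurs once.  It counts as unbarred next to an
   unbarred letter and as barred next to a barred one, hence the disjunctions in
   the first two clauses. *)
Definition is_descent k B (p : nat) : bool :=
  let i := nth k B p in let j := nth k B p.+1 in
  let bi := barred k B p in let bj := barred k B p.+1 in
  [|| [&& (i == k) || ~~ bi, (j == k) || ~~ bj & (j < i)%N],
      [&& (i == k) || bi, (j == k) || bj & (i < j)%N],
      [&& i != k, ~~ bi, j != k, bj & (k < i)%N]
    | [&& i != k, bi, j != k, ~~ bj & (j < k)%N]].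

Definition descents B : nat :=
  if [pick k | count_mem k B == 1%N] is Some k
  then #|[set p : 'I_(2 * n - 2) | is_descent k B p]%SET| else 0%N.

Definition biEulerian_number (i : nat) : nat :=
  #|[set B : word | bipermutation B & descents B == i]%SET|.

Definition biEulerian_polynomial : {poly int} :=
  \sum_(i < (2 * n - 2).+1) (biEulerian_number i)%:Z *: 'X^i.

End Bipermutations.

Section BipermutahedralFan.
Variables (R : realType) (n : nat).

Definition N_space : Type := quotv <[const_mx 1 : 'rV[R]_n]>%VS.
HB.instance Definition _ := Vector.on N_space.

Definition indicator (S : {set 'I_n}) : 'rV[R]_n := \row_i (i \in S)%:R.

Definition e_ (S : {set 'I_n}) : N_space * N_space := (quotv_pi _ (indicator S), 0).
Definition f_ (S : {set 'I_n}) : N_space * N_space := (0, quotv_pi _ (indicator S)).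

Definition bipermutation_rays (B : (2 * n - 1).-tuple 'I_n) : seq (N_space * N_space) :=
  [seq e_ [set x in take m B]%SET + f_ [set x in drop m B]%SET
     | m <- iota 1 (2 * n - 2)].

Definition bipermutahedral_fan : set (set (N_space * N_space)%type) :=
  [set C | exists2 B, bipermutation B & face_of C (cone (bipermutation_rays B))].

Lemma finite_bipermutahedral_fan : finite_set bipermutahedral_fan.
Proof.
rewrite (_ : bipermutahedral_fan =
  \bigcup_(B in [set B | bipermutation B])
     [set C | face_of C (cone (bipermutation_rays B))]); last first.
  by apply/seteqP; split=> C [B]; exists B.
apply: bigcup_finite; first exact: finite_finset.
by move=> B _; exact: finite_faces_cone.
Qed.

End BipermutahedralFan.

Arguments bipermutahedral_fan R n : clear implicits.

(* Main.v *)
(** A cone of the fan is described by the block in which each letter occurs first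
    and last, i.e. by a "pattern": a surjective map from the [2n] letters (first
    and second occurrences) onto [{0, ..., d}], with first occurrence at most
    second occurrence and equality for at least one element.  Modulo the lines
    [R(1, ..., 1)], the cone of a pattern [w] consists of the points whose
    coordinates are weakly increasing along [w], so the faces of dimension [d]
    are in bijection with the patterns onto [{0, ..., d}].

    For fixed [k], descents of a bipermutation are the ordinary descents of the
    sequence of keys of its letters, for one linear order on letters.  Hence a
    pattern arises from a unique bipermutation [B] and a unique set of [d] bars
    containing the descents of [B]: [k] must be the largest element whose two
    occurrences lie in the same block, and the letters of a block must be sorted
    by key.  Summing [x^(D - d)] over the sets of bars that contain the descents
    gives [(x + 1)^(D - des B)], which is the relation defining the h-vector. *)
Require Import Defs.
From mathcomp Require Import all_boot all_order all_algebra.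
From mathcomp Require Import boolp.
From mathcomp Require Import zify.

Set Implicit Arguments.
Unset Strict Implicit.
Unset Printing Implicit Defensive.

Import Order.TTheory GRing.Theory Num.Theory.

(** * Patterns and their coarsenings *)

Notation letter n := (bool * 'I_n)%type.

(* [w (false, i)] and [w (true, i)] are the blocks of the first and of the last
   occurrence of [i]. *)
Definition pattern n d (w : letter n -> nat) : Prop :=
  [/\ forall l, w l <= d,
      forall m, m <= d -> exists l, w l = m,
      forall i, w (false, i) <= w (true, i)
    & exists k, w (false, k) = w (true, k)].

(** A surjection onto an initial segment is determined by the preorder it induces: by induction on
    [u l], some letter at the previous level lies strictly below [l], for [u] and hence for [u']. *)
Lemma pattern_eq_of_le n d d' (w w' : letter n -> nat) :
  pattern d w -> pattern d' w' ->
  (forall l l', (w l <= w l') = (w' l <= w' l')) -> w =1 w'.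
Proof.
move=> [wd w_onto _ _] [w'd w'_onto _ _] ww'.
have half e (u u' : letter n -> nat) : (forall l, u l <= e) ->
    (forall m, m <= e -> exists l, u l = m) ->
    (forall l l', (u l <= u l') = (u' l <= u' l')) -> forall l, u l <= u' l.
  move=> ue u_onto uu' l; move: {2}(u l) (erefl (u l)) => m.
  elim: m l => [|m IHm] l ul; first by rewrite ul.
  have [l0 ul0] : exists l0, u l0 = m by apply: u_onto; have := ue l; lia.
  by have := IHm _ ul0; have := uu' l l0; rewrite ul ul0 ltnn => /esym; lia.
move=> l; apply/eqP; rewrite eqn_leq (half _ _ _ wd w_onto ww').
by rewrite (half _ _ _ w'd w'_onto (fun l l' => esym (ww' l l'))).
Qed.

(** With gap [t] between positions [t] and [t.+1], this is the index of the block of position [p]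
    when the bars are the gaps in [T]. *)
Definition rank D (T : {set 'I_D}) (p : nat) : nat := #|[set t in T | t < p]|.

Lemma rank0 D (T : {set 'I_D}) : rank T 0 = 0.
Proof. by apply: eq_card0 => t; rewrite !inE ltn0 andbF. Qed.

Lemma rank_full D (T : {set 'I_D}) : rank T D = #|T|.
Proof. by apply: eq_card => t; rewrite !inE ltn_ord andbT. Qed.

Lemma rankS D (T : {set 'I_D}) (j : 'I_D) : rank T j.+1 = rank T j + (j \in T).
Proof.
rewrite /rank addnC.
have [jT|jT] := boolP (j \in T).
  rewrite (cardsD1 j) !inE jT ltnSn /=; congr (_ + _); apply: eq_card => t.
  rewrite !inE ltnS; case: (eqVneq t j) => [->|tj]; first by rewrite ltnn andbF.
  by rewrite ltn_neqAle; move: tj; rewrite -val_eqE /= => ->.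
rewrite add0n; apply: eq_card => t; rewrite !inE ltnS.
case: (eqVneq t j) => [->|tj]; first by rewrite (negPf jT).
by rewrite ltn_neqAle; move: tj; rewrite -val_eqE /= => ->.
Qed.

Lemma rank_homo D (T : {set 'I_D}) : {homo rank T : p q / p <= q}.
Proof.
move=> p q pq; apply: subset_leq_card; apply/subsetP => t; rewrite !inE.
by case/andP=> -> /leq_trans->.
Qed.

(** [rank T] starts at [0], ends at [#|T|] and climbs by at most one per position. *)
Lemma rank_onto D (T : {set 'I_D}) m : m <= #|T| ->
  exists2 p, p <= D & rank T p = m.
Proof.
move=> mT; suff: forall p, p <= D -> m <= rank T p -> exists2 q, q <= D & rank T q = m.
  by move/(_ D (leqnn _)); apply; rewrite rank_full.
elim=> [|p IHp] pD; first by rewrite rank0 => ?; exists 0; rewrite ?rank0; lia.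
rewrite (rankS T (Ordinal pD)) /= => mp.
have [|ltm] := leqP m (rank T p); first by apply: IHp; apply: ltnW.
by exists p.+1 => //; rewrite (rankS T (Ordinal pD)) /=; case: (_ \in T) mp => /=; lia.
Qed.

Lemma pattern_rank n D (P : letter n -> nat) (T : {set 'I_D}) :
  pattern D P -> pattern #|T| (fun l => rank T (P l)).
Proof.
move=> [PD P_onto P01 [k Pk]]; split=> [l|m mT|i|].
- by rewrite -rank_full rank_homo.
- by have [p pD <-] := rank_onto mT; have [l <-] := P_onto p pD; exists l.
- exact: rank_homo.
- by exists k; rewrite Pk.
Qed.

(** * Positions of letters and the order inside a block *)

Section Positions.
Variables (n : nat) (k : 'I_n).
Implicit Types (P w : letter n -> nat).

Lemma card_letterD1 l : #|~: [set l : letter n]| = 2 * n - 1.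
Proof. by have := cardsC [set l]; rewrite cards1 card_prod card_bool card_ord; lia. Qed.

(** Deleting [(false, k)] leaves [2 * n - 1] letters that still cover the [2 * n - 1] positions,
    hence bijectively. *)
Lemma pattern_inj P : pattern (2 * n - 2) P -> P (false, k) = P (true, k) ->
  forall l l', P l = P l' -> l = l' \/ l.2 = k /\ l'.2 = k.
Proof.
move=> [PD P_onto _ _] Pk.
have n0 : 0 < n by case: (k) => *; lia.
pose L' := (~: [set (false, k)]).
have PD1 l : P l < 2 * n - 1 by have := PD l; lia.
pose Q l := Ordinal (PD1 l).
have QL' : (Q @: L' = setT).
  apply/setP => p; rewrite [RHS]inE; apply/imsetP.
  have [|l Pl] := P_onto p; first by have := ltn_ord p; lia.
  have [El|nl] := eqVneq l (false, k).
    by exists (true, k); rewrite ?inE //; apply/val_inj; rewrite /= -Pl El Pk.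
  by exists l; rewrite ?inE //; apply/val_inj.
have /imset_injP Qinj : #|(Q @: L')| == #|L'|.
  by rewrite QL' cardsT card_ord card_letterD1.
pose c l := if l == (false, k) then (true, k) else l.
have cP l : P (c l) = P l by rewrite /c; case: eqP => // ->.
have cL l : c l \in L' by rewrite /c !inE; case: (eqVneq l (false, k)).
move=> l l' Pll'.
have: c l = c l'.
  by apply: Qinj; rewrite ?cL //; apply/val_inj; rewrite /= !cP.
rewrite /c; case: eqP => [->|_]; case: eqP => [->|_]; auto.
- by move=> <-; right.
- by move=> ->; right.
Qed.

(* Orders the letters inside a block so that descents of a bipermutation become
   ordinary descents: unbarred letters below [k], then the barred letters and [k]
   in decreasing order, then unbarred letters above [k]. *)
Definition key (l : letter n) : nat :=
  if l.1 || (l.2 == k) then 2 * n - l.2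
  else if l.2 < k then (l.2 : nat) else 3 * n + l.2.

(** Lexicographic order by block, then key: every key is below [5 * n]. *)
Definition block_key w (l : letter n) : nat := w l * (5 * n) + key l.

Lemma key_lt l : key l < 5 * n.
Proof. by rewrite /key; case: l => b i /=; have := ltn_ord i; do 2?case: ifP; lia. Qed.

Lemma key_inj l l' : key l = key l' -> l = l' \/ l.2 = k /\ l'.2 = k.
Proof.
case: l l' => b i [b' i']; rewrite /key /= -!val_eqE /=.
have := ltn_ord i; have := ltn_ord i'.
case: (ltngtP i k) => ik; case: (ltngtP i' k) => i'k; case: b; case: b' => /= *;
  (try by exfalso; lia);
  by [right; split; apply/val_inj | left; congr pair; apply/val_inj => /=; lia].
Qed.

Lemma block_key_lt w l l' : (block_key w l < block_key w l') =
  (w l < w l') || (w l == w l') && (key l < key l').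
Proof.
rewrite /block_key; have := key_lt l; have := key_lt l'.
move: (key l) (key l') (5 * n) => a b M.
have [ww|ww|->] := ltngtP (w l) (w l') => bM aM /=; nia.
Qed.

Lemma block_key_inj w l l' : block_key w l = block_key w l' ->
  l = l' \/ l.2 = k /\ l'.2 = k.
Proof.
move=> E; apply: key_inj; have := block_key_lt w l l'; have := block_key_lt w l' l.
by rewrite E ltnn; case: (ltngtP (w l) (w l')) => //= _; lia.
Qed.

End Positions.

Lemma pattern_level n d d' (w : letter n -> nat) :
  pattern d w -> pattern d' w -> d = d'.
Proof.
move=> [wd w_onto _ _] [wd' w_onto' _ _].
have [l wl] := w_onto d (leqnn d); have [l' wl'] := w_onto' d' (leqnn d').
by have := wd l'; have := wd' l; lia.
Qed.

(** * Unique refinement of a pattern by positions and bars *)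

Section Refinement.
Variable n : nat.
Let D := 2 * n - 2.
Implicit Types (k : 'I_n) (P w : letter n -> nat) (T : {set 'I_D}).

(** Phrased through [key], without a word; [is_descent_key] gives the agreement with
    [is_descent]. *)
Definition descents_in k P T : Prop := forall (j : 'I_D) l l',
  P l = j -> P l' = j.+1 -> key k l' < key k l -> j \in T.

(** Between consecutive positions either a bar raises the block or, there being no descent, the key
    rises; letters sharing a position have equal keys. So block and key together recover the order
    of positions. *)
Lemma block_key_ltP k P T : pattern D P -> P (false, k) = P (true, k) ->
    descents_in k P T ->
  forall l l', (block_key k (fun x => rank T (P x)) l
                  < block_key k (fun x => rank T (P x)) l') = (P l < P l').
Proof.
move=> patP Pk desT; set w := fun x => _; have [PD P_onto _ _] := patP.
have eqk l l' : P l = P l' -> block_key k w l = block_key k w l'.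
  move=> Pll'; rewrite /block_key /w Pll'; congr (_ + _).
  case: (pattern_inj patP Pk Pll') => [-> //|[lk l'k]].
  by rewrite /key lk l'k eqxx !orbT.
have step j l l' : P l = j -> P l' = j.+1 -> block_key k w l < block_key k w l'.
  move=> Pl Pl'; have jD : j < D by have := PD l'; lia.
  rewrite block_key_lt /w Pl Pl' (rankS T (Ordinal jD)) /=.
  have [//|jT] := boolP (Ordinal jD \in T); first by rewrite addn1 ltnSn.
  (* Without a bar there is no descent, and equal keys would make both letters share a position. *)
  rewrite addn0 ltnn eqxx /= ltnNge leq_eqVlt negb_or; apply/andP; split.
    apply/eqP => /(@key_inj _ k) [ll'|[l'k lk]]; first by move: Pl'; rewrite ll'; lia.
    have Pk' l0 : l0.2 = k -> P l0 = P (true, k).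
      by case: l0 => [[] i] /= ->.
    by move: Pl'; rewrite (Pk' _ l'k) -(Pk' _ lk) Pl; lia.
  by apply: (contraNN _ jT); exact: (desT (Ordinal jD) l l').
have mono l l' : P l < P l' -> block_key k w l < block_key k w l'.
  move: {2}(P l') (erefl (P l')) => q; elim: q l' => [|q IHq] l' Pl'; first by rewrite Pl'.
  have [l0 Pl0] : exists l0, P l0 = q by apply: P_onto; have := PD l'; lia.
  rewrite Pl' ltnS leq_eqVlt => /orP[/eqP Pl|Plq].
    by rewrite (@step q l l').
  by apply: ltn_trans (step q l0 l' Pl0 Pl'); apply: IHq; rewrite ?Pl0.
move=> l l'; case: (ltngtP (P l) (P l')) => [/mono ->|/mono lt|/eqk ->] //.
  by rewrite ltnNge ltnW.
by rewrite ltnn.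
Qed.

(** If both occurrences of [i <> k] lie in one block, the unbarred one has the smaller key, which
    excludes [i > k] since unbarred letters above [k] come last. Thus the block map determines
    [k]. *)
Lemma max_coincidence k P T : pattern D P -> P (false, k) = P (true, k) ->
    descents_in k P T ->
  forall i, rank T (P (false, i)) = rank T (P (true, i)) -> i <= k.
Proof.
move=> patP Pk desT i wi; have [_ _ P01 _] := patP.
have [->//|ik] := eqVneq i k.
have Plt : P (false, i) < P (true, i).
  rewrite ltn_neqAle P01 andbT; apply/eqP => /(pattern_inj patP Pk) [//|[/= Eik]].
  by rewrite Eik eqxx in ik.
have := block_key_ltP patP Pk desT (false, i) (true, i).
rewrite Plt block_key_lt wi ltnn eqxx /= /key /= (negPf ik).
by case: (ltnP i k) => [/ltnW //|_]; have := ltn_ord i; lia.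
Qed.

(** The block map determines [k] as its largest coincidence, then [P] through [block_key], then [T]
    as the set of jumps. *)
Lemma refinement_unique k k' P P' T T' :
    pattern D P -> P (false, k) = P (true, k) -> descents_in k P T ->
    pattern D P' -> P' (false, k') = P' (true, k') -> descents_in k' P' T' ->
    (forall l, rank T (P l) = rank T' (P' l)) ->
  P =1 P' /\ T = T'.
Proof.
move=> patP Pk desT patP' Pk' desT' E.
have Ek : k = k'.
  apply/val_inj/eqP; rewrite eqn_leq; apply/andP; split => /=.
    by apply: (max_coincidence patP' Pk' desT'); rewrite -!E Pk.
  by apply: (max_coincidence patP Pk desT); rewrite !E Pk'.
subst k'; have EP : P =1 P'.
  apply: (pattern_eq_of_le patP patP') => l l'.
  rewrite leqNgt -(block_key_ltP patP Pk desT) block_key_lt !E.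
  rewrite -(block_key_lt k (fun x => rank T' (P' x))).
  by rewrite (block_key_ltP patP' Pk' desT') -leqNgt.
split=> //; apply/setP => j; have [_ P_onto _ _] := patP.
have [l Pl] : exists l, P l = j by apply: P_onto; exact: ltnW.
have [l' Pl'] : exists l', P l' = j.+1 by apply: P_onto; exact: ltn_ord.
have := E l'; rewrite -EP Pl' !rankS.
have := E l; rewrite -EP Pl => ->.
by move/addnI; do 2!case: (_ \in _).
Qed.

(** Take [k] to be the largest coincidence of [w], sort the letters by [block_key], and put a bar
    wherever [w] rises. *)
Lemma exists_refinement d w : pattern d w ->
  exists k, exists P, exists T,
    [/\ pattern D P, P (false, k) = P (true, k), descents_in k P T
      & forall l, w l = rank T (P l)].
Proof.
move=> [wd w_onto w01 [k0 wk0]].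
have [k wk kmax] : exists2 k, w (false, k) = w (true, k)
    & forall i, w (false, i) = w (true, i) -> i <= k.
  have Q0 : w (false, k0) == w (true, k0) by apply/eqP.
  case: (@arg_maxnP _ k0 (fun i => w (false, i) == w (true, i)) val Q0) => k /eqP wk kmax.
  by exists k => // i /eqP/kmax.
pose W := block_key k w.
have Wk : W (false, k) = W (true, k).
  by rewrite /W /block_key wk /key eqxx.
(* Dropping [(false, k)], tied with [(true, k)], makes [P l] below count distinct block keys. *)
pose L' := ~: [set (false, k)] : {set letter n}.
have L'P l : exists2 l0, l0 \in L' & W l0 = W l.
  have [->|nl] := eqVneq l (false, k); last by exists l; rewrite // !inE.
  by exists (true, k); rewrite ?inE.
pose P l := #|[set l0 in L' | W l0 < W l]|.
have Pmono l l' : W l < W l' -> P l < P l'.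
  move=> Wll'; have [l1 l1L' Wl1] := L'P l.
  apply: proper_card; apply/properP; split.
    by apply/subsetP => x; rewrite !inE => /andP[-> /ltn_trans->].
  by exists l1; rewrite inE l1L' Wl1 ?ltnn.
have Peq l l' : W l = W l' -> P l = P l' by rewrite /P => ->.
have Plt l l' : (P l < P l') = (W l < W l').
  case: (ltngtP (W l) (W l')) => [/Pmono ->|/Pmono lt|/Peq ->] //.
    by rewrite ltnNge ltnW.
  by rewrite ltnn.
have n0 : 0 < n by case: (k) => *; lia.
have PD l : P l < 2 * n - 1.
  have [l1 l1L' Wl1] := L'P l.
  rewrite -(card_letterD1 (false, k)) -(Peq _ _ Wl1); apply: proper_card.
  apply/properP; split; first by apply/subsetP => x; rewrite !inE => /andP[].
  by exists l1 => //; rewrite inE ltnn andbF.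
pose Q l := Ordinal (PD l).
have QL' : Q @: L' = setT.
  apply/eqP; rewrite eqEcard subsetT cardsT card_ord card_in_imset ?card_letterD1 ?leqnn //.
  move=> l l' lL' l'L' /(congr1 val) /= PE.
  have /block_key_inj[//|[]] : W l = W l'.
    by have := Plt l l'; have := Plt l' l; rewrite PE ltnn; lia.
  case: l l' lL' l'L' {PE} => [[] i] [[] i']; rewrite !inE !xpair_eqE /= => + + Ei Ei';
  by rewrite ?Ei ?Ei' ?eqxx.
have P_onto m : m <= D -> exists l, P l = m.
  move=> mD; have mD' : m < 2 * n - 1 by move: mD; rewrite /D; lia.
  have /imsetP[l _ El] : Ordinal mD' \in Q @: L' by rewrite QL' inE.
  by exists l; rewrite -[m]/(val (Ordinal mD')) El.
have P01 i : P (false, i) <= P (true, i).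
  rewrite leqNgt Plt block_key_lt negb_or -leqNgt w01 /=.
  (* Maximality of [k] enters here: within one block, [i <= k] puts the first occurrence no later
     than the second. *)
  apply/negP => /andP[/eqP wi]; have := kmax i (esym wi).
  rewrite /key /= -val_eqE /=; have := ltn_ord i.
  by case: (ltngtP i k) => //= *; lia.
have patP : pattern D P.
  split=> //; last by exists k; exact: Peq.
  by move=> l; have := PD l; rewrite /D; lia.
have wP l l' : P l <= P l' -> w l <= w l'.
  by rewrite leqNgt Plt block_key_lt; lia.
pose T := [set j : 'I_D | [exists l, [exists l',
  [&& P l == j, P l' == j.+1 & w l < w l']]]].
have wrank l : w l = rank T (P l).
  move: {2 3}(P l) (erefl (P l)) => p; elim: p l => [|p IHp] l Pl.
    have [l0 wl0] := w_onto 0 (leq0n d).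
    by have := @wP l l0; rewrite Pl wl0 rank0 => /(_ isT); lia.
  have pD : p < D by have := PD l; rewrite /D; lia.
  have [l1 Pl1] : exists l1, P l1 = p by apply: P_onto; lia.
  rewrite (rankS T (Ordinal pD)) /= -(IHp l1) //.
  have wl1l : w l1 <= w l by apply: wP; lia.
  (* A value skipped by [w] would be attained at some [l2], with no position left for it between
     [l1] and [l]. *)
  have wS : w l <= (w l1).+1.
    rewrite leqNgt; apply/negP => wlt.
    have [l2 wl2] : exists l2, w l2 = (w l1).+1 by apply: w_onto; have := wd l; lia.
    have [Pl2|Pl2] := leqP (P l2) (P l1); first by have := wP _ _ Pl2; lia.
    have Pl' : P l <= P l2 by lia.
    by have := wP _ _ Pl'; lia.
  have -> : (Ordinal pD \in T) = (w l1 < w l).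
    rewrite inE; apply/existsP/idP => [[x /existsP[y]]|ww]; last first.
      by exists l1; apply/existsP; exists l; rewrite /= Pl1 Pl ww !eqxx.
    rewrite /= => /and3P[/eqP Px /eqP Py].
    have xl1 : w l1 <= w x by apply: wP; lia.
    have yl : w y <= w l by apply: wP; lia.
    by lia.
  by case: ltnP; lia.
exists k, P, T; split=> //; first exact: Peq.
move=> j l l' Pl Pl' kll'; rewrite inE; apply/existsP; exists l; apply/existsP; exists l'.
rewrite Pl Pl' !eqxx /=.
(* Since [l] precedes [l'] for [W], a drop in [key] forces a rise of [w]. *)
have := Plt l l'; rewrite Pl Pl' ltnSn block_key_lt.
by case: ltnP => //= _ /esym /andP[_]; lia.
Qed.

End Refinement.

(** * Bipermutations as patterns *)

Section Words.
Variable n : nat.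
Notation D := (2 * n - 2).
Notation word := ((2 * n - 1).-tuple 'I_n).
Implicit Types (B : word) (k i : 'I_n) (P : letter n -> nat) (T : {set 'I_D}).

Definition occurrences B P : Prop := forall i (p : 'I_(2 * n - 1)),
  (tnth B p == i) = (P (false, i) == p) || (P (true, i) == p).

Lemma occurrences_word_inj B B' P : occurrences B P -> occurrences B' P -> B = B'.
Proof.
move=> occ occ'; apply: eq_from_tnth => p; apply/eqP.
by rewrite occ -occ' eqxx.
Qed.

Lemma pattern_lt P l : pattern D P -> P l < 2 * n - 1.
Proof. by case=> /(_ l) Pl _ _ [k _]; have := ltn_ord k; lia. Qed.

(** The word gives the set of positions of [i]; its minimum and maximum are the two values at
    [i]. *)
Lemma occurrences_pattern_inj B P P' : pattern D P -> pattern D P' ->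
  occurrences B P -> occurrences B P' -> P =1 P'.
Proof.
move=> patP patP' occ occ' [b i].
have [_ _ /(_ i) P01 _] := patP; have [_ _ /(_ i) P'01 _] := patP'.
have sub Q Q' c : pattern D Q -> occurrences B Q -> occurrences B Q' ->
    (Q' (false, i) == Q (c, i)) || (Q' (true, i) == Q (c, i)).
  move=> patQ oQ oQ'; have := oQ' i (Ordinal (pattern_lt (c, i) patQ)).
  by rewrite oQ /= => <-; case: c; rewrite eqxx ?orbT.
move: (sub P P' false patP occ occ') (sub P P' true patP occ occ').
move: (sub P' P false patP' occ' occ) (sub P' P true patP' occ' occ).
by case: b; lia.
Qed.

Lemma count_mem_tnth B i : count_mem i B = #|[set p | tnth B p == i]|.
Proof.
rewrite cardsE cardE size_filter -[X in count _ X](map_tnth_enum B) count_map.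
by rewrite enumT.
Qed.

Lemma count_occurrences B P i : pattern D P -> occurrences B P ->
  count_mem i B = (P (false, i) != P (true, i)).+1.
Proof.
move=> patP occ; rewrite count_mem_tnth.
pose Q l := Ordinal (pattern_lt l patP).
rewrite (_ : [set p | _] = [set Q (false, i); Q (true, i)]) ?cards2 //.
by apply/setP => p; rewrite !inE occ -!val_eqE /= ![val p == _]eq_sym.
Qed.

(** The letter at a position is read off any preimage; distinct preimages are the two occurrences of
    [k] and carry the same letter. *)
Lemma bipermutation_of_pattern P : pattern D P ->
  exists2 B, bipermutation B & occurrences B P.
Proof.
move=> patP; have [PD P_onto P01 [k Pk]] := patP.
have n0 : 0 < n by case: (k) => *; lia.
have /choice[g Pg] : forall p : 'I_(2 * n - 1), exists l, P l = p.
  by move=> p; apply: P_onto; have := ltn_ord p; lia.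
pose B : word := [tuple (g p).2 | p < 2 * n - 1].
have occ : occurrences B P.
  move=> i p; rewrite tnth_mktuple; apply/eqP/orP => [<-|].
    by case: (g p) (Pg p) => [[] j] /= ->; rewrite eqxx; auto.
  have unb b : P (b, i) == p -> (g p).2 = i.
    by rewrite -Pg => /eqP/(pattern_inj patP Pk)[<- //|[/= -> ->]].
  by case=> /unb.
exists B => //; apply/existsP; exists k; rewrite (count_occurrences _ patP occ) Pk eqxx /=.
apply/forallP => i; apply/implyP => ik; rewrite (count_occurrences _ patP occ).
by case: (P _ =P _) => // /(pattern_inj patP Pk) [//|[/= Eik]]; rewrite Eik eqxx in ik.
Qed.

Lemma pattern_of_bipermutation B : bipermutation B ->
  exists2 P, pattern D P & occurrences B P.
Proof.
case/existsP=> k /andP[Bk /forallP Bi].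
have n0 : 0 < n by case: (k) => *; lia.
(* [g i] holds the positions of [i] in increasing order, one position repeated for [k]. *)
have /choice[g gP] : forall i, exists q : 'I_(2 * n - 1) * 'I_(2 * n - 1),
    q.1 <= q.2 /\ [set p | tnth B p == i] = [set q.1; q.2].
  move=> i; have [->|ik] := eqVneq i k.
    move: Bk; rewrite count_mem_tnth => /cards1P[p ->].
    by exists (p, p); rewrite setUid.
  have := Bi i; rewrite ik count_mem_tnth /= => /cards2P[p [q [_ ->]]].
  have [pq|/ltnW qp] := leqP p q; first by exists (p, q).
  by exists (q, p); rewrite setUC.
pose P (l : letter n) : nat := if l.1 then (g l.2).2 else (g l.2).1.
have occ : occurrences B P.
  move=> i p; have [_ /setP/(_ p)] := gP i; rewrite !inE => ->.
  by rewrite /P /= ![p == _]eq_sym.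
exists P => //; split.
- move=> l; suff: P l < 2 * n - 1 by lia.
  by rewrite /P; case: ifP.
- move=> m mD; have mD' : m < 2 * n - 1 by lia.
  have := occ (tnth B (Ordinal mD')) (Ordinal mD'); rewrite eqxx.
  case/esym/orP=> /eqP Pm; first by exists (false, tnth B (Ordinal mD')).
  by exists (true, tnth B (Ordinal mD')).
- by move=> i; have [] := gP i.
- exists k; move: Bk; rewrite count_mem_tnth; have [_ ->] := gP k.
  by rewrite cards2 /P /=; case: ((g k).1 =P (g k).2) => [->|].
Qed.

(** This justifies [key]: once [barred] is read off the labels, the four descent clauses match key
    comparison in each case of barredness and of position relative to [k]. *)
Lemma is_descent_key B P k l l' p : pattern D P -> occurrences B P ->
  P (false, k) = P (true, k) -> P l = p -> P l' = p.+1 ->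
  is_descent k B p = (key k l' < key k l).
Proof.
move=> patP occ Pk Pl Pl'.
have nthB x : nth k B (P x) = x.2.
  have := occ x.2 (Ordinal (pattern_lt x patP)); rewrite (tnth_nth k) /=.
  by case: x => [[] i] /=; rewrite eqxx ?orbT => /eqP.
(* Both labels of [k] name a single position, which is never barred. *)
have barredB x : barred k B (P x) = x.1 && (x.2 != k).
  rewrite /barred nthB; case: x => b i /=.
  have sB : size B = 2 * n - 1 by rewrite size_tuple.
  have [_ _ /(_ i) P01 _] := patP.
  have PS := pattern_lt (b, i) patP.
  apply/(nthP k)/andP => [[q]|[b1 ik]].
    rewrite size_take sB PS => qP; rewrite nth_take // => Bq.
    have qS : q < 2 * n - 1 by lia.
    have := occ i (Ordinal qS); rewrite (tnth_nth k) /= Bq eqxx => Eq.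
    split; first by case: b PS qP => //; lia.
    by apply/eqP => ik; move: Pk; rewrite -ik; case: b PS qP; lia.
  exists (P (false, i)); last first.
    rewrite nth_take; first exact: (nthB (false, i)).
    rewrite b1 ltn_neqAle P01 andbT; apply/eqP => /(pattern_inj patP Pk)[//|[/= Ei]].
    by rewrite Ei eqxx in ik.
  rewrite size_take sB PS b1 ltn_neqAle P01 andbT; apply/eqP.
  by move/(pattern_inj patP Pk)=> [//|[/= Ei]]; rewrite Ei eqxx in ik.
rewrite /is_descent -Pl' -Pl !nthB !barredB.
case: l l' {Pl Pl'} => b i [b' i']; rewrite /key /= -!val_eqE /=.
have := ltn_ord i; have := ltn_ord i'.
by case: (ltngtP i k); case: (ltngtP i' k); case: b; case: b' => //= *; lia.
Qed.
End Words.

(** * Counting *)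

(** Expand a product of factors [1 + 0] for [i] in [S] and [1 + x] otherwise, with [T] the set of
    factors contributing [1]; a [T] missing an element of [S] contributes zero. *)
Lemma sum_supersets (A : comNzRingType) D (S : {set 'I_D}) (x : A) :
  (\sum_(T : {set 'I_D} | S \subset T) x ^+ (D - #|T|) = (x + 1) ^+ (D - #|S|))%R.
Proof.
have cardC (T : {set 'I_D}) : D - #|T| = #|~: T|.
  by have := cardsC T; rewrite card_ord; lia.
transitivity (\prod_(i < D) (1 + if i \in S then 0 else x))%R; last first.
  rewrite cardC -prodr_const [RHS]big_mkcond; apply: eq_bigr => i _ /=.
  by rewrite inE addrC; case: (i \in S); rewrite ?add0r.
rewrite bigA_distr big_mkcond; apply: eq_bigr => T _.
have [ST|/subsetPn[i iS iT]] := boolP (S \subset T).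
  rewrite cardC -prodr_const [LHS]big_mkcond; apply: eq_bigr => i _ /=.
  rewrite in_setC; have [//|iT] := boolP (i \in T).
  by have [/(subsetP ST)|//] := boolP (i \in S); rewrite (negPf iT).
by rewrite (bigD1 i) //= (negPf iT) iS mul0r.
Qed.

Section Flags.
Variable n : nat.
Notation D := (2 * n - 2).
Notation word := ((2 * n - 1).-tuple 'I_n).
Implicit Types (B : word).

Definition descent_set B : {set 'I_D} :=
  if [pick k | count_mem k B == 1] is Some k
  then [set p : 'I_D | is_descent k B p] else set0.

Lemma card_descent_set B : descents B = #|descent_set B|.
Proof. by rewrite /descents /descent_set; case: pickP => [//|_]; rewrite cards0. Qed.

Lemma descent_setP B P : pattern D P -> occurrences B P ->
  exists2 k, P (false, k) = P (true, k)
    & forall T, descents_in k P T <-> descent_set B \subset T.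
Proof.
move=> patP occ; rewrite /descent_set; case: pickP => [k|noB]; last first.
  have [_ _ _ [k Pk]] := patP.
  by have := noB k; rewrite (count_occurrences _ patP occ) Pk eqxx.
rewrite (count_occurrences _ patP occ); case: (P (false, k) =P _) => // Pk _.
exists k => // T; split=> [desT|desT j l l' Pl Pl'].
  apply/subsetP => j; rewrite inE => dj; have [_ P_onto _ _] := patP.
  have [l Pl] : exists l, P l = j by apply: P_onto; exact: ltnW.
  have [l' Pl'] : exists l', P l' = j.+1 by apply: P_onto; exact: ltn_ord.
  by apply: (desT j l l') => //; rewrite -(is_descent_key patP occ Pk Pl Pl').
rewrite -(is_descent_key patP occ Pk Pl Pl') => dj.
by apply: (subsetP desT); rewrite inE.
Qed.

Definition pattern_set d : {set {ffun letter n -> 'I_d.+1}} :=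
  [set w : {ffun letter n -> 'I_d.+1} | `[< pattern d (fun l => w l : nat) >]].

Definition marked_bipermutations d : {set word * {set 'I_D}} :=
  [set BT : word * {set 'I_D} |
    [&& bipermutation BT.1, descent_set BT.1 \subset BT.2 & #|BT.2| == d]].

(** Sending [(B, T)] to the block map of [B] cut at [T] is injective by [refinement_unique] and
    surjective by [exists_refinement]. *)
Lemma card_pattern_set d : #|pattern_set d| = #|marked_bipermutations d|.
Proof.
(* [pos B] is the position pattern of [B], arbitrary when [B] is not a bipermutation. *)
have /choice[pos posP] : forall B, exists P, bipermutation B ->
    pattern D P /\ occurrences B P.
  move=> B; have [bB|] := boolP (bipermutation B); last by exists (fun=> 0).
  by have [P patP occ] := pattern_of_bipermutation bB; exists P.
pose f (BT : word * {set 'I_D}) : {ffun letter n -> 'I_d.+1} :=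
  [ffun l => inord (rank BT.2 (pos BT.1 l))].
have fE BT : BT \in marked_bipermutations d ->
    forall l, f BT l = rank BT.2 (pos BT.1 l) :> nat.
  case: BT => B T; rewrite inE /= => /and3P[/posP[patB _] _ /eqP cT] l.
  rewrite ffunE inordK // ltnS -cT.
  by have [] := pattern_rank T patB.
rewrite (_ : pattern_set d = f @: marked_bipermutations d).
  rewrite card_in_imset // => -[B T] [B' T'] BTm BTm' E.
  have {}E l : rank T (pos B l) = rank T' (pos B' l).
    by rewrite -(fE _ BTm) E (fE _ BTm').
  move: BTm BTm'; rewrite !inE /=.
  move=> /and3P[/posP[patB occB] desB _] /and3P[/posP[patB' occB'] desB' _].
  have [k Pk /(_ T) [_ /(_ desB) dk]] := descent_setP patB occB.
  have [k' Pk' /(_ T') [_ /(_ desB') dk']] := descent_setP patB' occB'.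
  have [EP ET] := refinement_unique patB Pk dk patB' Pk' dk' E.
  congr pair => //; apply: (occurrences_word_inj occB) => i p.
  by rewrite !EP; exact: occB'.
apply/setP => w; rewrite inE; apply/asboolP/imsetP => [patw|[[B T] BTm ->]].
  have [k [P [T [patP Pk desT wE]]]] := exists_refinement patw.
  have [B bB occ] := bipermutation_of_pattern patP.
  have [patB occB] := posP _ bB.
  have PE := occurrences_pattern_inj patP patB occ occB.
  have cT : #|T| = d.
    apply: (@pattern_level n _ _ (fun l => w l : nat)) => //.
    rewrite (_ : (fun l => _) = fun l => rank T (P l)); first exact: pattern_rank.
    exact/funext.
  have BTm : (B, T) \in marked_bipermutations d.
    rewrite inE /= bB cT eqxx andbT /=.
    have [k' Pk' dk'] := descent_setP patP occ; apply/dk'.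
    suff -> : k' = k by [].
    have := count_occurrences k' patP occ; rewrite Pk' eqxx /=.
    by have [//|[] ] := pattern_inj patP Pk Pk'.
  by exists (B, T) => //; apply/ffunP => l; apply/ord_inj; rewrite fE //= wE PE.
have -> : (fun l => f (B, T) l : nat) = fun l => rank T (pos B l).
  by apply/funext => l; rewrite fE.
move: BTm; rewrite inE /= => /and3P[/posP[patB _] _ /eqP <-].
exact: pattern_rank.
Qed.

Local Open Scope ring_scope.

(** Both sides sum ['X^(D - #|T|)] over bipermutations with bars [T] containing the descents:
    grouping by descent number gives the left side, grouping by [#|T|] the right. *)
Lemma pattern_set_is_h_vector :
  is_h_vector (fun d => #|pattern_set d|)
    [ffun i : 'I_D.+1 => (biEulerian_number n i)%:Z].
Proof.
have desD B : (descents B < D.+1)%N.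
  by rewrite card_descent_set ltnS -[X in (_ <= X)%N]card_ord max_card.
rewrite /is_h_vector.
transitivity (\sum_(B : word | bipermutation B) ('X + 1) ^+ (D - descents B) : {poly int}).
  rewrite (partition_big (fun B => Ordinal (desD B)) predT) //=; apply: eq_bigr => i _.
  rewrite ffunE (eq_bigr (fun=> ('X + 1) ^+ (D - i))); last first.
    by move=> B /andP[_ /eqP <-].
  rewrite sumr_const -scaler_nat natz; congr (_%:Z *: _).
  by rewrite /biEulerian_number cardsE; apply: eq_card.
transitivity (\sum_(BT : word * {set 'I_D} | bipermutation BT.1
      && (descent_set BT.1 \subset BT.2)) 'X^(D - #|BT.2|) : {poly int}).
  rewrite -(pair_big_dep (fun B => bipermutation B)
    (fun B (T : {set 'I_D}) => descent_set B \subset T) (fun B T => 'X^(D - #|T|))) /=.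
  by apply: eq_bigr => B _; rewrite sum_supersets card_descent_set.
have cD (BT : word * {set 'I_D}) : (#|BT.2| < D.+1)%N.
  by rewrite ltnS -[X in (_ <= X)%N]card_ord max_card.
rewrite (partition_big (fun BT => Ordinal (cD BT)) predT) //=; apply: eq_bigr => i _.
rewrite card_pattern_set (eq_bigr (fun=> 'X^(D - i))); last first.
  by move=> BT /andP[_ /eqP <-].
rewrite sumr_const -scaler_nat natz; congr (_%:Z *: _).
by rewrite cardsE; apply: eq_card => BT; rewrite !unfold_in /= andbA.
Qed.
End Flags.

From mathcomp Require Import finmap classical_sets cardinality reals lra.

(** * Cones of patterns *)

Local Open Scope ring_scope.
Local Open Scope classical_set_scope.

Section SimplicialCones.
Variables (R : realType) (V : vectType R).
Implicit Types (C F : set V) (s : seq V).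

Lemma cone_dim_unique C d d' : cone_dim C d -> cone_dim C d' -> d = d'.
Proof.
move=> [U [CU Umin <-]] [U' [CU' U'min <-]]; congr (\dim _).
by apply: subv_anti; rewrite Umin // U'min.
Qed.

Definition subcone s d (T : {set 'I_d}) : set V :=
  [set x | exists2 c : 'I_d -> R,
     forall i, 0 <= c i /\ (i \notin T -> c i = 0) & x = \sum_(i < d) c i *: s`_i].

(** Freeness supplies the supporting functional: the sum of the coordinates outside [T] is
    nonnegative on the cone and vanishes exactly on the subcone. *)
Lemma face_of_free_cone s d F : size s = d -> free s ->
  face_of F (cone s) <-> exists T : {set 'I_d}, F = subcone s T.
Proof.
move=> <- {d} frs; split=> [/face_of_cone //|[T ->]].
pose u : 'Hom(V, R^o) := \sum_(i | i \notin T) linfun (coord (in_tuple s) i : V -> R^o).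
have uE (c : 'I_(size s) -> R) :
    u (\sum_i c i *: s`_i) = \sum_(i | i \notin T) c i.
  rewrite sum_lfunE; apply: eq_bigr => i _; rewrite lfunE.
  exact: (coord_sum_free c i (X := in_tuple s)).
exists u => [x [c c0 ->]|]; first by rewrite uE; exact: sumr_ge0.
apply/seteqP; split=> [x [c cT ->]|x [[c c0 ->]]] /=.
  split; first by exists c => // i; have [] := cT i.
  by rewrite uE big1 // => i /(cT i).2.
rewrite uE => /eqP; rewrite psumr_eq0 // => /allP c0T.
exists c => // i; split=> // iT; apply/eqP.
by have := c0T i (mem_index_enum i); rewrite iT.
Qed.

End SimplicialCones.

Section PatternCones.
Variables (R : realType) (n : nat).
Local Notation V := (N_space R n * N_space R n)%type.
Implicit Types (z : letter n -> R) (w : letter n -> nat).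

(** Modulo constants, the indicator of a prefix is minus that of its complement. The sign therefore
    makes coordinates in both factors increase along the word. *)
Definition point z : V :=
  (quotv_pi _ (\row_i - z (false, i)), quotv_pi _ (\row_i z (true, i))).

Lemma point_linear a z z' :
  point (fun l => a * z l + z' l) = a *: point z + point z'.
Proof.
apply: injective_projections => /=; rewrite -linearP; congr quotv_pi;
  by apply/rowP => i; rewrite !mxE ?mulrN ?opprD.
Qed.

Lemma point0 : point (fun=> 0) = 0.
Proof.
apply: injective_projections; rewrite /= -[RHS](linear0 (quotv_pi _));
  by congr quotv_pi; apply/rowP => i; rewrite !mxE ?oppr0.
Qed.

Lemma point_sum I (r : seq I) (c : I -> R) (z : I -> letter n -> R) :
  point (fun l => \sum_(j <- r) c j * z j l) = \sum_(j <- r) c j *: point (z j).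
Proof.
elim: r => [|j r IHr].
  by rewrite big_nil -point0; congr point; apply/funext => l; rewrite big_nil.
rewrite big_cons -IHr -point_linear; congr point; apply/funext => l.
by rewrite big_cons.
Qed.

Lemma quotv_pi_row_eq (x y : 'I_n -> R) :
  quotv_pi <[const_mx 1 : 'rV[R]_n]>%VS (\row_i x i) = quotv_pi _ (\row_i y i) <->
  exists a, forall i, x i = y i + a.
Proof.
split=> [/quotv_eq/vlineP[a E]|[a E]].
  exists a => i; have := congr1 (fun v : 'rV[R]_n => v 0 i) E.
  by rewrite !mxE mulr1 => xya; lra.
apply/quotv_eq/vlineP; exists a; apply/rowP => i.
by rewrite !mxE mulr1 E addrC addKr.
Qed.

Lemma point_eq z z' : point z = point z' <->
  (exists a, forall i, z (false, i) = z' (false, i) + a)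
  /\ exists b, forall i, z (true, i) = z' (true, i) + b.
Proof.
split=> [[/quotv_pi_row_eq[a Ea] /quotv_pi_row_eq[b Eb]]|[[a Ea] [b Eb]]].
  split; last by exists b.
  by exists (- a) => i; have := Ea i; lra.
rewrite /point; congr pair; apply/quotv_pi_row_eq; last by exists b.
by exists (- a) => i; rewrite Ea opprD.
Qed.

Definition monotone_for w z : Prop := forall l l', (w l <= w l')%N -> z l <= z l'.

Definition pattern_cone w : set V :=
  [set x | exists2 z, monotone_for w z & x = point z].

Definition ray w (j : nat) : V := point (fun l => (j < w l)%:R).

Definition rays w d : seq V := mkseq (ray w) d.

Lemma sum_rays w d (c : 'I_d -> R) :
  \sum_(j < d) c j *: (rays w d)`_j
  = point (fun l => \sum_(j < d) c j * (j < w l)%:R).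
Proof.
rewrite point_sum; apply: eq_bigr => j _.
by rewrite nth_mkseq.
Qed.

Lemma sum_thresholds d (g : nat -> R) p : (p <= d)%N ->
  \sum_(j < d) (g j.+1 - g j) * (j < p)%:R = g p - g 0%N.
Proof.
move=> pd; rewrite -(telescope_sumr _ (leq0n p)) (big_nat_widen _ _ d) //.
rewrite [RHS]big_mkcond big_mkord /=; apply: eq_bigr => j _.
by case: (_ < _)%N; rewrite ?mulr1 ?mulr0.
Qed.

(** The coefficient of the [j]th ray is the increment of [z] from block [j] to block [j.+1]:
    nonnegative by monotonicity, zero where no bar separates them. *)
Lemma subcone_rays w d (T : {set 'I_d}) : pattern d w ->
  subcone (rays w d) T = pattern_cone (fun l => rank T (w l)).
Proof.
move=> [wd w_onto _ _]; apply/seteqP; split=> x [].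
  move=> c cT ->; rewrite sum_rays; eexists; last by [].
  move=> l l' rll'; apply: ler_sum => j _; have [c0 cT0] := cT j.
  have [jT|/cT0 ->] := boolP (j \in T); last by rewrite !mul0r.
  apply: ler_wpM2l => //; rewrite ler_nat.
  have [jl|//] := ltnP j (w l); have [//|l'j] := ltnP j (w l').
  have := rank_homo T l'j; have := rank_homo T jl; rewrite rankS jT; lia.
move=> z zmono ->.
have /choice[f fP] : forall m, exists l, (m <= d)%N -> w l = m.
  move=> m; have [md|_] := leqP m d; first by have [l] := w_onto m md; exists l.
  by have [l _] := w_onto 0%N (leq0n d); exists l.
pose g m := z (f m).
have gw l : z l = g (w l).
  by apply/eqP; rewrite eq_le !zmono // fP.
exists (fun j : 'I_d => g j.+1 - g j).
  move=> j; rewrite subr_ge0; split=> [|jT].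
    by apply: zmono; rewrite !fP ?rankS ?leq_addr // ltnW.
  apply/eqP; rewrite subr_eq0 eq_le !zmono // !fP ?rankS ?(negPf jT) ?addn0 //.
    by rewrite ltnW.
  by rewrite ltnW.
(* Telescoping leaves the constant [g 0], killed in both factors. *)
rewrite sum_rays; apply/point_eq; split; exists (g 0%N) => i;
  by rewrite sum_thresholds ?wd // gw subrK.
Qed.

(** The two factors allow independent constants; a letter with tied occurrences forces them to
    agree. *)
Lemma point_eq_tied z z' k : point z = point z' ->
  z (false, k) = z (true, k) -> z' (false, k) = z' (true, k) ->
  exists a, forall l, z l = z' l + a.
Proof.
move=> /point_eq[[a Ea] [b Eb]] zk z'k; exists a => -[[] i //].
by rewrite Eb; congr (_ + _); have := Ea k; have := Eb k; lra.
Qed.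

(** A vanishing combination is constant on letters, while its values on blocks [j.+1] and [j] differ
    by [c j]. *)
Lemma rays_free w d : pattern d w -> free (rays w d).
Proof.
move=> [wd w_onto _ [k wk]].
have sz : size (rays w d) = d by rewrite size_mkseq.
rewrite -[rays w d]/(tval (Tuple (introT eqP sz))); apply/freeP => c /=.
rewrite sum_rays -point0 => /(@point_eq_tied _ _ k) [|//|a Ea].
  by rewrite wk.
move=> j; have [l wl] := w_onto j (ltnW (ltn_ord j)).
have [l' wl'] := w_onto j.+1 (ltn_ord j).
have : \sum_(i < d) c i * (i < w l')%:R - \sum_(i < d) c i * (i < w l)%:R = c j.
  rewrite -sumrB (bigD1 j) //= wl wl' ltnSn ltnn mulr1 mulr0 subr0 big1 ?addr0 //.
  move=> i ij; rewrite ltnS leq_eqVlt; move: ij; rewrite -val_eqE /= => /negPf ->.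
  by rewrite subrr.
by rewrite !Ea subrr => <-.
Qed.

Lemma pattern_cone_dim w d : pattern d w -> cone_dim (pattern_cone w) d.
Proof.
move=> patw; have sz : size (rays w d) = d by rewrite size_mkseq.
have rank_setT p : (p <= d)%N -> rank [set: 'I_d]%SET p = p.
  elim: p => [|p IHp] pd; first by rewrite rank0.
  by rewrite (rankS _ (Ordinal pd)) /= IHp ?inE ?addn1 // ltnW.
have coneE : pattern_cone w = subcone (rays w d) [set: 'I_d]%SET.
  rewrite subcone_rays //; congr pattern_cone; apply/funext => l.
  by rewrite rank_setT //; have [] := patw.
exists <<rays w d>>%VS; split.
- rewrite coneE => x [c _ ->]; apply: memv_suml => j _.
  by rewrite memvZ // memv_span // mem_nth // sz.
- move=> W CW; apply/span_subvP => _ /mapP[j _ ->]; apply: CW.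
  exists (fun l => (j < w l)%:R) => // l l' ll'; rewrite ler_nat.
  by have [jl|//] := ltnP j (w l); rewrite (leq_trans jl ll').
- by have /eqP := rays_free patw; rewrite sz.
Qed.

(** Test the cones on the point with coordinates [w]: in the second cone it has coordinates monotone
    for [w'], equal to [w] up to one constant. *)
Lemma pattern_cone_le w w' d d' : pattern d w -> pattern d' w' ->
  pattern_cone w = pattern_cone w' -> forall l l', (w' l <= w' l' -> w l <= w l')%N.
Proof.
move=> [wd w_onto w01 [k wk]] [w'd w'_onto w'01 [k' wk']] E l l' ll'.
have : pattern_cone w (point (fun l => (w l)%:R)).
  by exists (fun l => (w l)%:R) => // x y; rewrite ler_nat.
rewrite E => -[z zmono] /point_eq[[a Ea] [b Eb]].
have z01 i : z (false, i) <= z (true, i) by exact: zmono.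
have zk' : z (false, k') = z (true, k').
  by apply/eqP; rewrite eq_le !zmono // wk'.
(* The letter [k], tied for [w], gives [b <= a]; the letter [k'], tied for [z], gives [a <= b]. *)
have ab : a = b.
  have wk'01 : ((w (false, k'))%:R : R) <= (w (true, k'))%:R by rewrite ler_nat.
  have := Ea k; have := Eb k; have := Ea k'; have := Eb k'; have := z01 k.
  rewrite wk; lra.
have wz x : (w x)%:R = z x + a by case: x => [[] i]; rewrite ?Ea ?Eb ?ab.
by rewrite -(ler_nat R) !wz lerD2r zmono.
Qed.

Lemma pattern_cone_inj w w' d d' : pattern d w -> pattern d' w' ->
  pattern_cone w = pattern_cone w' -> w =1 w'.
Proof.
move=> patw patw' E; apply: (pattern_eq_of_le patw patw') => l l'; apply/idP/idP.
  exact: (pattern_cone_le patw' patw (esym E)).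
exact: (pattern_cone_le patw patw' E).
Qed.

End PatternCones.

(** * The fan as the set of pattern cones, and its f-vector *)

Section Fan.
Variables (R : realType) (n : nat).
Notation D := (2 * n - 2)%N.
Notation word := ((2 * n - 1).-tuple 'I_n).
Implicit Types (B : word) (P w : letter n -> nat).

Lemma bipermutation_raysE B P : pattern D P -> occurrences B P ->
  bipermutation_rays R B = rays R P D.
Proof.
move=> patP occ.
suff rayE (j : nat) : (j < D)%N ->
    e_ R [set x in take j.+1 B]%SET + f_ R [set x in drop j.+1 B]%SET = ray R P j.
  rewrite /bipermutation_rays (iotaDl 1 0) -map_comp.
  by apply/eq_in_map => j; rewrite mem_iota add0n; exact: rayE.
move=> jD; have [PD _ P01 [k _]] := patP.
have nthB b i : nth k B (P (b, i)) = i.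
  have := occ i (Ordinal (pattern_lt (b, i) patP)); rewrite (tnth_nth k) /=.
  by case: b; rewrite eqxx ?orbT => /eqP.
have posB i q : (q < 2 * n - 1)%N -> nth k B q = i -> P (false, i) = q \/ P (true, i) = q.
  move=> qS Bq; have := occ i (Ordinal qS); rewrite (tnth_nth k) /= Bq eqxx.
  by case/esym/orP=> /eqP; auto.
have sB : size B = (2 * n - 1)%N by rewrite size_tuple.
have takeB (i : 'I_n) : (i \in take j.+1 B) = (P (false, i) <= j)%N.
  apply/(nthP k)/idP => [[q]|Pj].
    rewrite size_take sB => qj; have {}qj : (q <= j /\ q < 2 * n - 1)%N.
      by move: qj; case: ifP; lia.
    have [qj1 qS] := qj; rewrite nth_take // => /(posB _ _ qS) Pq.
    by have := P01 i; case: Pq; lia.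
  exists (P (false, i)); last by rewrite nth_take // nthB.
  by rewrite size_take sB; case: ifP; lia.
have dropB (i : 'I_n) : (i \in drop j.+1 B) = (j < P (true, i))%N.
  apply/(nthP k)/idP => [[q]|Pj].
    rewrite size_drop sB nth_drop => qS.
    have {}qS : (j.+1 + q < 2 * n - 1)%N by lia.
    by move=> /(posB _ _ qS) Pq; have := P01 i; case: Pq; lia.
  exists (P (true, i) - j.+1)%N; last by rewrite nth_drop subnKC.
  by rewrite size_drop sB; have := pattern_lt (true, i) patP; lia.
rewrite /ray /point /e_ /f_; apply: injective_projections => /=.
  (* The constant [1] passes from the prefix indicator to minus the indicator of its complement. *)
  rewrite addr0; apply/quotv_pi_row_eq; exists 1 => i.
  by rewrite inE takeB; case: leqP => _; rewrite ?oppr0 ?add0r ?addNr.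
rewrite add0r; apply/quotv_pi_row_eq; exists 0 => i.
by rewrite addr0 inE dropB.
Qed.

(** Faces of the cone of [B] come from sets of bars, hence from coarsenings of its position pattern;
    conversely every pattern refines to a bipermutation. *)
Lemma bipermutahedral_fanP C : bipermutahedral_fan R n C <->
  exists d, exists2 w, pattern d w & C = pattern_cone w.
Proof.
split=> [[B bB]|[d [w patw ->]]].
  have [P patP occ] := pattern_of_bipermutation bB.
  rewrite (bipermutation_raysE patP occ).
  rewrite (face_of_free_cone _ (size_mkseq _ _) (rays_free R patP)) => -[T].
  rewrite subcone_rays // => ->; exists #|T|, (fun l => rank T (P l)) => //.
  exact: pattern_rank.
have [k [P [T [patP Pk _ wE]]]] := exists_refinement patw.
have [B bB occ] := bipermutation_of_pattern patP.
exists B => //; rewrite (bipermutation_raysE patP occ).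
rewrite (face_of_free_cone _ (size_mkseq _ _) (rays_free R patP)); exists T.
by rewrite subcone_rays //; congr pattern_cone; apply/funext.
Qed.

(** Distinct patterns have distinct cones, and the dimension of the cone recovers the top block
    index. *)
Lemma f_vector_bipermutahedral_fan d :
  f_vector (bipermutahedral_fan R n) d = #|pattern_set n d|.
Proof.
pose f (w : {ffun letter n -> 'I_d.+1}) : set (N_space R n * N_space R n) :=
  pattern_cone (fun l => w l : nat).
have f_inj : {in pattern_set n d &, injective f}.
  move=> w w'; rewrite !inE => patw patw' ww'.
  by apply/ffunP => l; apply/ord_inj; have := pattern_cone_inj patw patw' ww' l.
rewrite /f_vector cardE -[RHS](card_in_imfset tt f_inj); congr (#|` _|).
apply/fsetP => C; rewrite in_fset_set; last first.
  apply: sub_finite_set (finite_bipermutahedral_fan R n) => C'.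
  by case.
apply/idP/imfsetP => [|[w]] /=.
  rewrite inE => -[/bipermutahedral_fanP[d' [w patw ->]]].
  move/(cone_dim_unique (pattern_cone_dim R patw)) => d'd; subst d'.
  have wd l : (w l < d.+1)%N by case: patw => wd _ _ _; exact: wd.
  have wE : (fun l => [ffun l => Ordinal (wd l)] l : nat) = w.
    by apply/funext => l; rewrite ffunE.
  exists [ffun l => Ordinal (wd l)]; last by rewrite /f wE.
  by rewrite inE; apply/asboolP; rewrite wE.
rewrite !inE => patw ->; split => /=.
  by apply/bipermutahedral_fanP; exists d, (fun l => w l : nat).
exact: pattern_cone_dim.
Qed.

End Fan.

Theorem theorem4p3 (R : realType) (n : nat) (hn : (2 <= n)%N) :
  h_polynomial (2 * n - 2) (f_vector (bipermutahedral_fan R n))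
    = biEulerian_polynomial n
  /\ forall i : 'I_(2 * n - 2).+1,
       h_vector (2 * n - 2) (f_vector (bipermutahedral_fan R n)) i
         = (biEulerian_number n i)%:Z.
Proof.
have -> : f_vector (bipermutahedral_fan R n) = fun d => #|pattern_set n d|.
  by apply/funext => d; exact: f_vector_bipermutahedral_fan.
(* The defining identity determines the h-vector, and the descent counts satisfy it. *)
have hE := is_h_vector_inj (h_vectorP (2 * n - 2) _) (pattern_set_is_h_vector n).
by split=> [|i]; rewrite /h_polynomial /biEulerian_polynomial hE ?ffunE //;
  apply: eq_bigr => i _; rewrite ffunE.
Qed.
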